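(* Let $n\geq 1$ and let $B_n=\operatorname{conv}\{P(\pi)\mid \pi\in S_n\}\subseteq\mathbb{R}^{n\times n}$ be the Birkhoff polytope, whose vertices $P(\pi)$ are identified with the permutations $\pi\in S_n$. For every combinatorial symmetry $\alpha$ of $B_n$ (viewed as a permutation of $S_n$) there are $\sigma,\tau\in S_n$ and $\varepsilon\in\{\pm1\}$ such that $\alpha(\pi)=\sigma\pi^{\varepsilon}\tau$ for all $\pi\in S_n$. Moreover, every combinatorial symmetry of $B_n$ is induced by an isometry of the space $\mathbb{R}^{n\times n}$ of $n\times n$ real matrices.
   Context: $P(\pi)$ denotes the $n\times n$ permutation matrix of $\pi\in S_n$. A combinatorial symmetry of a polytope is a permutation of its vertex set that maps (vertex sets of) faces onto (vertex sets of) faces. *)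

(* Defs.v *)
From HB Require Import structures.
From mathcomp Require Import all_boot all_order all_algebra all_fingroup.
From mathcomp Require Import boolp classical_sets functions reals convex.

Set Implicit Arguments.
Unset Strict Implicit.
Unset Printing Implicit Defensive.

Import Order.TTheory GRing.Theory Num.Theory.
Local Open Scope classical_set_scope.
Local Open Scope ring_scope.

Section Polytopes.
Variables (R : realType) (V : lmodType R).
Implicit Types (P F G X : set V) (f : V -> V).

Definition conv_hull X : set V := smallest (@convex_set R V) X.

(* The zero functional is allowed, so the empty set and P itself are faces. *)
Definition is_face P F :=
  exists (l : {scalar V}) (c : R),
    (forall x, P x -> l x <= c) /\ F = P `&` [set x | l x = c].

Definition vertices P : set V := [set v | is_face P [set v]].

(* Only the values of f on the vertices of P matter. *)
Definition combinatorial_symmetry P f :=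
  set_bij (vertices P) (vertices P) f /\
  forall F, is_face P F ->
    exists2 G, is_face P G & f @` (F `&` vertices P) = G `&` vertices P.

End Polytopes.

Definition birkhoff (R : realType) (n : nat) : set 'M[R]_n :=
  conv_hull (range (@perm_mx R n)).

(* The norm `|A| of the library is the max norm on matrices, hence an explicit
   Euclidean distance. *)
Definition euclidean_dist (R : realType) (m n : nat) (A B : 'M[R]_(m, n)) : R :=
  Num.sqrt (\sum_i \sum_j (A i j - B i j) ^+ 2).

Definition euclidean_isometry (R : realType) (m n : nat)
    (Phi : 'M[R]_(m, n) -> 'M[R]_(m, n)) :=
  bijective Phi /\
  forall A B, euclidean_dist (Phi A) (Phi B) = euclidean_dist A B.

(* Main.v *)
Require Import Defs.
From HB Require Import structures.
From mathcomp Require Import all_boot all_order all_algebra all_fingroup.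
From mathcomp Require Import boolp classical_sets functions reals convex.
From mathcomp Require Import interval_inference.

Import Order.TTheory GRing.Theory Num.Theory.
Local Open Scope ring_scope.

(** The vertex sets of the faces of B_n are the sets of optimal permutations of
    assignment problems, and the facets (for n >= 3) are the sets
    N i j = {p | p i <> j}. That every proper face lies in some N i j follows
    from linear programming duality: longest-path potentials relative to one
    optimal permutation turn the weights into nonnegative slacks, all of which
    vanish if the face meets the complement of every N i j. A combinatorial
    symmetry therefore permutes the N i j. The complements of N i j and N k l
    are disjoint iff (i, j) and (k, l) are distinct and share a row or a column,
    so the induced map on pairs is an automorphism of the rook graph, that is a
    pair of permutations of rows and columns, possibly followed by a
    transposition. *)

(** * Potentials from heaviest simple paths *)

Section Potential.
Variables (R : realDomainType) (T : finType).
Implicit Types (w e : T -> T -> R) (s p : seq T).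

Fixpoint walk_weight e x s : R :=
  if s is y :: s' then e x y + walk_weight e y s' else 0.

Lemma walk_weight_cat e x s1 s2 :
  walk_weight e x (s1 ++ s2) = walk_weight e x s1 + walk_weight e (last x s1) s2.
Proof. by elim: s1 x => [|y s1 IH] x /=; rewrite ?add0r // IH addrA. Qed.

(** The closing point [y0] is kept apart from the head [y] so that the induction can advance the
    head. *)
Lemma sum_next_at e y0 y p : uniq (y :: p) ->
  \sum_(z <- y :: p) e z (next_at z y0 y p) = walk_weight e y (rcons p y0).
Proof.
elim: p y => [|y' p IH] y; first by rewrite big_seq1 /= eqxx addr0.
move=> /= /andP[yp Up]; rewrite big_cons eqxx -IH //; congr (_ + _).
rewrite big_seq [RHS]big_seq; apply: eq_bigr => z zp.
by case: eqP => // zy; rewrite -zy zp in yp.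
Qed.

(** The cyclic successor on [x :: s] is a permutation of [T] fixing all other points, where [e]
    vanishes; its total weight is that of the cycle. *)
Lemma cycle_weight_le0 e x s :
    (forall z, e z z = 0) -> (forall q : {perm T}, \sum_z e z (q z) <= 0) ->
  uniq (x :: s) -> walk_weight e x (rcons s x) <= 0.
Proof.
move=> e0 le_e Us; rewrite -sum_next_at //.
have next_inj : injective (next (x :: s)) by exact: can_inj (prev_next Us).
apply: le_trans (le_e (perm next_inj)); rewrite le_eqVlt; apply/orP; left.
rewrite [X in _ == X](bigID (mem (x :: s))) /= [X in _ + X]big1 ?addr0.
  by rewrite -big_uniq //; apply/eqP/eq_bigr => z _; rewrite permE.
by move=> z zs; rewrite permE next_nth (negPf zs) e0.
Qed.

(** Duplicate-free sequences have length at most [#|T|], so the maximum can be taken over the finite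
    type [S] of tuples of bounded length. *)
Lemma exists_max_uniq (F : seq T -> R) x :
  exists2 s, uniq (x :: s) & forall s', uniq (x :: s') -> F s' <= F s.
Proof.
pose S := {k : 'I_#|T|.+1 & k.-tuple T}.
pose pack (k : 'I_#|T|.+1) (t : k.-tuple T) : S :=
  @Tagged _ k (fun k : 'I_#|T|.+1 => k.-tuple T) t.
pose t0 := pack ord0 [tuple].
case: (@arg_maxP _ R S t0 (fun t => uniq (x :: tagged t))
         (fun t => F (tagged t))) => // t Ut tmax.
exists (tagged t) => // s' Us'.
have sz : (size s' < #|T|.+1)%N.
  by rewrite ltnS -(card_uniqP (proj2 (andP Us'))) max_card.
exact: (tmax (pack (Ordinal sz) (in_tuple s'))).
Qed.

(* The potential of y is the largest weight of a simple path ending at y;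
   paths are read backwards, hence the transposed weights. *)
Lemma potential w :
    (forall q : {perm T}, \sum_z w z (q z) <= \sum_z w z z) ->
  exists v : T -> R, forall x y, w x y - w x x <= v y - v x.
Proof.
move=> w_max; pose e x y := w y x - w y y.
have e0 z : e z z = 0 by rewrite /e subrr.
have le_e (q : {perm T}) : \sum_z e z (q z) <= 0.
  rewrite (reindex_inj (@perm_inj _ q^-1)) /=.
  under eq_bigr do rewrite permKV.
  by rewrite sumrB subr_le0.
have /choice[m mP] x : exists s, uniq (x :: s) /\ forall s',
    uniq (x :: s') -> walk_weight e x s' <= walk_weight e x s.
  by have [s Us sP] := exists_max_uniq (walk_weight e x) x; exists s.
exists (fun x => walk_weight e x (m x)) => x y; rewrite lerBrDr.
have [Ux _] := mP x; have [_ ymax] := mP y.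
(* If [y] is off the best path of [x], prepending [y] gives a simple path that competes with
   [m y]. *)
have [y_in|y_notin] := boolP (y \in x :: m x); last first.
  have := ymax (x :: m x); rewrite [uniq _]/= y_notin -/(uniq _) => /(_ Ux).
  by rewrite /= {1}/e.
have -> : w x y - w x x + walk_weight e x (m x) = walk_weight e y (x :: m x).
  by [].
(* The walk from [y] along [x :: m x] returns to [y]: it is a cycle, of weight at most 0, followed
   by a simple path from [y]. *)
case/splitPr: y_in Ux => s1 s2; rewrite cat_uniq => /and3P[U1 N U2].
rewrite -cat_rcons walk_weight_cat last_rcons -[leRHS]add0r lerD ?ymax //.
apply: cycle_weight_le0 => //=; rewrite U1 andbT.
by move: N; rewrite /= negb_or => /andP[].
Qed.

End Potential.

(** * Automorphisms of the rook graph *)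

Section Rook.
Variable n : nat.
Implicit Types (phi : 'I_n -> 'I_n -> 'I_n * 'I_n) (x y z : 'I_n * 'I_n).

Definition collinear x y := (x.1 == y.1) || (x.2 == y.2).

Definition preserves_collinear phi := forall i j k l,
  collinear (i, j) (k, l) -> collinear (phi i j) (phi k l).

Definition injective_pair phi := forall i j k l,
  phi i j = phi k l -> (i, j) = (k, l).

(** Pairwise collinear points lie on one line: if two of them differ in row they share a column, and
    a third point, being in the row of at most one of them, shares that column. *)
Lemma row_image phi i : injective_pair phi -> preserves_collinear phi ->
  (exists a, forall j, (phi i j).1 = a) \/ (exists a, forall j, (phi i j).2 = a).
Proof.
move=> phi_inj phi_col.
have row j k : collinear (phi i j) (phi i k).
  by apply: phi_col; rewrite /collinear eqxx.
have [h|] := boolP [forall j, (phi i j).1 == (phi i i).1].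
  by left; exists (phi i i).1 => j; apply/eqP; move/forallP: h.
rewrite negb_forall => /existsP[j1 N1]; right.
have /orP[E|/eqP E1] := row j1 i; first by rewrite E in N1.
exists (phi i i).2 => k.
have /orP[/eqP Ek1|/eqP Ek] := row k i; last by [].
have /orP[/eqP Ek2|/eqP Ek] := row k j1; first by rewrite -Ek2 Ek1 eqxx in N1.
by rewrite Ek E1.
Qed.

Lemma rook_rows phi i0 a0 : injective_pair phi -> preserves_collinear phi ->
    (forall j, (phi i0 j).1 = a0) ->
  exists a b : 'S_n, forall i j, phi i j = (a i, b j).
Proof.
move=> phi_inj phi_col row0.
have row_onto i a : (forall j, (phi i j).1 = a) ->
    forall l, exists j, phi i j = (a, l).
  move=> rowi l.
  have inj2 : injective (fun j => (phi i j).2).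
    move=> j k Ejk; suff [] : (i, j) = (i, k) by [].
    by apply: phi_inj; rewrite [LHS]surjective_pairing [RHS]surjective_pairing !rowi Ejk.
  have [h _ hK] := injF_bij inj2; exists (h l).
  by rewrite [LHS]surjective_pairing rowi hK.
(* A row sent into column [c] would fill it and so hit [(a0, c)], which is already an image from row
   [i0]. *)
have rows i : exists a, forall j, (phi i j).1 = a.
  case: (row_image phi i phi_inj phi_col) => // -[c colc].
  exists a0 => j; have [k Ek] := row_onto _ _ row0 c.
  have [] := eqVneq i i0 => [->|ii0]; first exact: row0.
  have inj1 : injective (fun j => (phi i j).1).
    move=> j' k' Ejk; suff [] : (i, j') = (i, k') by [].
    by apply: phi_inj; rewrite [LHS]surjective_pairing [RHS]surjective_pairing !colc Ejk.
  have [h _ hK] := injF_bij inj1.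
  have [E _] : (i, h a0) = (i0, k).
    by apply: phi_inj; rewrite Ek [LHS]surjective_pairing hK colc.
  by rewrite E eqxx in ii0.
(* If rows [i] and [k] had the same image row, row [i] would fill it and hit the image of
   [(k, k)]. *)
have a_inj : injective (fun i => (phi i i0).1).
  move=> i k Eik; have [c rowi] := rows i; have [d rowk] := rows k.
  move: Eik; rewrite rowi rowk => Ecd; rewrite -Ecd in rowk.
  have [j Ej] := row_onto _ _ rowi (phi k k).2.
  suff [] : (i, j) = (k, k) by [].
  by apply: phi_inj; rewrite Ej [RHS]surjective_pairing rowk.
have b_inj : injective (fun j => (phi i0 j).2).
  move=> j k Ejk; suff [] : (i0, j) = (i0, k) by [].
  apply: phi_inj.
  by rewrite [LHS]surjective_pairing [RHS]surjective_pairing !row0 Ejk.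
exists (perm a_inj), (perm b_inj) => i j; rewrite !permE.
rewrite [LHS]surjective_pairing; congr pair.
  by have [c rowi] := rows i; rewrite !rowi.
have [-> //|ii0] := eqVneq i i0.
(* Points of one column have collinear images, which lie in distinct rows by [a_inj], hence in one
   column. *)
have /orP[/eqP E|/eqP //] : collinear (phi i j) (phi i0 j).
  by apply: phi_col; rewrite /collinear eqxx orbT.
have E' : (phi i i0).1 = (phi i0 i0).1.
  by have [c rowi] := rows i; move: E; rewrite !rowi !row0.
by rewrite (a_inj _ _ E') eqxx in ii0.
Qed.

Lemma rook_automorphism phi : injective_pair phi -> preserves_collinear phi ->
  exists (a b : 'S_n) (eps : bool), forall i j,
    phi i j = if eps then (b j, a i) else (a i, b j).
Proof.
move=> phi_inj phi_col; have [i0 _|no] := pickP (@predT 'I_n); last first.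
  by exists 1%g, 1%g, false => i; have := no i.
case: (row_image phi i0 phi_inj phi_col) => -[c rowc].
  have [a [b abP]] := rook_rows phi _ _ phi_inj phi_col rowc.
  by exists a, b, false.
pose psi i j := ((phi i j).2, (phi i j).1).
have psi_inj : injective_pair psi.
  move=> i j k l [E2 E1]; apply: phi_inj.
  by rewrite [LHS]surjective_pairing [RHS]surjective_pairing E1 E2.
have psi_col : preserves_collinear psi.
  by move=> i j k l /phi_col; rewrite /collinear orbC.
have [a [b abP]] := rook_rows psi _ _ psi_inj psi_col rowc.
exists a, b, true => i j; rewrite [LHS]surjective_pairing.
by have [-> ->] := abP i j.
Qed.

End Rook.

(** * Faces as sets of optimal permutations *)

Section PermFaces.
Variables (R : realDomainType) (n : nat).
Implicit Types (A : {set 'S_n}) (p q : 'S_n).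

Definition perm_weight (w : 'I_n -> 'I_n -> R) p := \sum_i w i (p i).

Definition perm_face A := exists w c,
  (forall p, perm_weight w p <= c) /\ A = [set p | perm_weight w p == c].

Definition avoid (i j : 'I_n) : {set 'S_n} := [set p : 'S_n | p i != j].

Lemma perm_face_avoid i j : perm_face (avoid i j).
Proof.
have E p : perm_weight (fun k l => - ((k == i) && (l == j))%:R) p
           = - (p i == j)%:R.
  rewrite /perm_weight (bigD1 i) //= eqxx big1 ?addr0 // => k /negPf->.
  by rewrite oppr0.
exists (fun k l => - ((k == i) && (l == j))%:R), 0; split=> [p|].
  by rewrite E oppr_le0 ler0n.
apply/setP=> p; rewrite !inE E; case: (p i == j); last by rewrite oppr0 eqxx.
by rewrite oppr_eq0 oner_eq0.
Qed.

(* With potentials relative to an optimal p, the slack c - weight q is a sum of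
   nonnegative terms d i (q i), so a face meeting every (i, j) has d = 0. *)
Lemma perm_face_sub_avoid (i0 : 'I_n) A : perm_face A -> A != [set: 'S_n] ->
  exists i j, A \subset avoid i j.
Proof.
move=> [w [c [w_le defA]]] A_neqT; apply: contrapT => no_avoid.
have cover i j : exists2 p, p \in A & p i = j.
  apply: contrapT => N; apply: no_avoid; exists i, j; apply/fintype.subsetP=> p pA.
  by rewrite inE; apply/eqP => Ep; apply: N; exists p.
have [p0 p0A _] := cover i0 i0.
have wp0 : perm_weight w p0 = c by move: p0A; rewrite defA inE => /eqP.
have shift q : \sum_i w i (p0 (q i)) = perm_weight w (q * p0)%g.
  by apply: eq_bigr => i _; rewrite permM.
(* Relabelling the columns by [p0] makes the identity optimal, as [potential] requires. *)
have [|v vP] := @potential R 'I_n (fun i j => w i (p0 j)).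
  by move=> q; rewrite shift -/(perm_weight w p0) wp0.
pose d i j := (v j - v i) - (w i (p0 j) - w i (p0 i)).
have d_ge0 i j : 0 <= d i j by rewrite subr_ge0.
have sum_d q : \sum_i d i (q i) = c - perm_weight w (q * p0)%g.
  rewrite /d !sumrB shift -/(perm_weight w p0) wp0.
  by rewrite -(reindex_inj (@perm_inj _ q) (P := predT)) subrr sub0r opprB.
have d0 i j : d i j = 0.
  have [p pA pij] := cover i (p0 j).
  have /eqP := sum_d (p * p0^-1)%g; rewrite mulgKV.
  move: pA; rewrite defA inE => /eqP->; rewrite subrr psumr_eq0 // => /allP.
  by move=> /(_ i (mem_index_enum i)); rewrite permM pij permK => /eqP.
move/eqP: A_neqT; apply; apply/setP=> p; rewrite defA !inE eq_sym -subr_eq0.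
have := sum_d (p * p0^-1)%g; rewrite mulgKV => <-.
by rewrite big1 ?eqxx // => i _; rewrite d0.
Qed.

Lemma perm2_exists {i k j l : 'I_n} : i != k -> j != l ->
  exists p : 'S_n, p i = j /\ p k = l.
Proof.
move=> ik jl; exists (tperm i j * tperm (tperm i j k) l)%g.
rewrite !permM !tpermL; split=> //; apply: tpermD; last by rewrite eq_sym.
by rewrite -[X in _ != X](tpermL i j) (inj_eq perm_inj) eq_sym.
Qed.

(** For [i != k], a permutation sending [k] to [l] can send [i] to a third value [m], different from
    [j] and [l]. For n = 2 this fails: the two diagonal positions define the same set. *)
Lemma avoid_sub_eq i j k l : (2 < n)%N -> avoid i j \subset avoid k l ->
  (i, j) = (k, l).
Proof.
move=> n_gt2 /fintype.subsetP sub; apply: contrapT => N.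
suff [p []] : exists p : 'S_n, p i != j /\ p k = l.
  by move=> pij pkl; have := sub p; rewrite !inE pkl eqxx => /(_ pij).
have [Eik|ik] := eqVneq i k.
  exists (tperm k l); rewrite Eik tpermL; split=> //.
  by apply: contra_notN N => /eqP->; rewrite Eik.
have /card_gt0P[m] : (0 < #|~: [set j; l]|)%N.
  rewrite -(ltn_add2l #|[set j; l]|) cardsC addn0 card_ord cards2.
  by case: (j != l) => //; apply: ltnW.
rewrite !inE negb_or => /andP[mj ml].
by have [p [pi pk]] := perm2_exists ik ml; exists p; rewrite pi.
Qed.

(** There are at most two permutations, so [alpha] is determined by its value at 1 and is a
    translation. *)
Lemma perm_Sn_le2 (alpha : {perm 'S_n}) p :
  (n <= 2)%N -> alpha p = (alpha 1 * p)%g.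
Proof.
move=> n_le2; have [->|p1] := eqVneq p 1%g; first by rewrite mulg1.
apply: contrapT => /eqP N.
have : (#|[set alpha 1%g; alpha p; (alpha 1 * p)%g]| <= 2)%N.
  apply: leq_trans (max_card _) _; rewrite card_Sn.
  by case: n n_le2 => [|[|[|]]].
rewrite finset.setUC cardsU1 cards2 !inE (inj_eq perm_inj) [1%g == p]eq_sym p1.
by rewrite -{2}[alpha 1%g]mulg1 (inj_eq (mulgI _)) (negPf p1) eq_sym (negPf N).
Qed.

Variable alpha : {perm 'S_n}.
Hypothesis alpha_face : forall A, perm_face A -> perm_face (alpha @: A).

(** Taking images under [alpha] is an injective self-map of the finite set of faces, hence onto. *)
Lemma perm_face_onto A : perm_face A -> exists2 B, perm_face B & A = alpha @: B.
Proof.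
move=> fA; pose F := [set B | `[< perm_face B >]].
have imF : [set alpha @: B | B : {set 'S_n} in F] = F.
  apply/eqP; rewrite eqEcard card_imset ?leqnn ?andbT; last first.
    exact: imset_inj perm_inj.
  apply/fintype.subsetP=> _ /imsetP[B BF ->]; move: BF; rewrite !inE => fB.
  exact: alpha_face.
have : A \in F by rewrite !inE.
by rewrite -imF => /imsetP[B]; rewrite !inE => fB ->; exists B.
Qed.

(** The image lies in some [avoid k l], whose preimage [B] is a proper face and lies in some
    [avoid i' j']. Then [avoid_sub_eq] collapses the chain from [avoid i j] through [B] to
    [avoid i' j']. *)
Lemma image_avoid i j : (2 < n)%N -> exists k l, alpha @: avoid i j = avoid k l.
Proof.
move=> n_gt2; have alphaT A : alpha @: A = [set: 'S_n] -> A = [set: 'S_n].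
  move=> E; apply/setP=> p; rewrite inE -(mem_imset A p (@perm_inj _ alpha)).
  by rewrite E inE.
have avoid_neqT k l : avoid k l != [set: 'S_n].
  apply/eqP=> /setP/(_ (tperm k l)).
  by rewrite !inE tpermL eqxx.
have neq : alpha @: avoid i j != [set: 'S_n].
  by apply: contraNneq (avoid_neqT i j) => /alphaT->.
have [k [l sub]] :=
  perm_face_sub_avoid i _ (alpha_face _ (perm_face_avoid i j)) neq.
have [B fB defB] := perm_face_onto _ (perm_face_avoid k l).
have B_neqT : B != [set: 'S_n].
  apply: contraNneq (avoid_neqT k l) => BT; rewrite defB BT.
  apply/eqP/setP=> p; rewrite inE -[p](permKV alpha) mem_imset ?inE //.
  exact: perm_inj.
have [i' [j' subB]] := perm_face_sub_avoid i _ fB B_neqT.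
have sub' : avoid i j \subset B.
  apply/fintype.subsetP=> p pA; rewrite -(mem_imset B p (@perm_inj _ alpha)) -defB.
  by apply: (fintype.subsetP sub); apply: imset_f.
have [Ei Ej] := avoid_sub_eq _ _ _ _ n_gt2 (fintype.subset_trans sub' subB).
have -> : avoid i j = B by apply/eqP; rewrite finset.eqEsubset sub' Ei Ej subB.
by exists k, l.
Qed.

Lemma perm_face_automorphism : exists (sigma tau : 'S_n) (eps : bool),
  forall p, alpha p = (sigma * (if eps then p^-1 else p) * tau)%g.
Proof.
have [n_le2|n_gt2] := leqP n 2.
  by exists (alpha 1%g), 1%g, false => p; rewrite mulg1 perm_Sn_le2.
have /choice[phi phiP] x : exists y, alpha @: avoid x.1 x.2 = avoid y.1 y.2.
  by have [k [l E]] := image_avoid x.1 x.2 n_gt2; exists (k, l).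
have memP p i j : (p i == j) = (alpha p (phi (i, j)).1 == (phi (i, j)).2).
  have /setP/(_ (alpha p)) := phiP (i, j).
  by rewrite mem_imset ?inE; [move/negb_inj | exact: perm_inj].
have phi_inj : injective_pair _ (fun i j => phi (i, j)).
  move=> i j k l E; apply: avoid_sub_eq => //; apply/fintype.subsetP=> p.
  by rewrite !inE (memP p i j) (memP p k l) E.
have phi_col : preserves_collinear _ (fun i j => phi (i, j)).
  move=> i j k l col; have [E|N] := eqVneq (i, j) (k, l).
    by rewrite /= E /collinear eqxx.
  (* Were the images not collinear, some [q] would pass through both; its preimage under [alpha]
     would pass through two distinct collinear positions. *)
  apply: contrapT => /negP; rewrite negb_or => /andP[N1 N2].
  have [q [q1 q2]] := perm2_exists N1 N2.
  have /eqP pij : (alpha^-1%g q) i == j by rewrite memP permKV q1.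
  have /eqP pkl : (alpha^-1%g q) k == l by rewrite memP permKV q2.
  case/orP: col => /= /eqP E; move/eqP: N; apply.
    by rewrite -pij -pkl E.
  by move: pkl; rewrite -E -pij => /perm_inj->.
have [a [b [eps abP]]] := rook_automorphism _ _ phi_inj phi_col.
(* Products apply the left factor first. With transposition, [p i = j] iff [alpha p (b j) = a i], so
   [alpha p] is [b^-1], then [p^-1], then [a]. *)
case: eps abP => abP.
  exists (b^-1)%g, a, true => p; apply/permP=> x; rewrite !permM.
  have := memP p (p^-1%g (b^-1%g x)) (b^-1%g x).
  by rewrite abP permKV eqxx /= permKV => /esym/eqP.
exists (a^-1)%g, b, false => p; apply/permP=> x; rewrite !permM.
have := memP p (a^-1%g x) (p (a^-1%g x)).
by rewrite abP eqxx /= permKV => /esym/eqP.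
Qed.

End PermFaces.

(** * From faces of the polytope to sets of permutations *)

Section BirkhoffPolytope.
Variables (R : realType) (n : nat).
Local Notation Bn := (@birkhoff R n).
Implicit Types (l : {scalar 'M[R]_n}) (X Y : 'M[R]_n) (p q : 'S_n).

Lemma birkhoff_perm p : Bn (perm_mx p).
Proof. by apply: sub_gen_smallest; exists p. Qed.

Lemma birkhoff_ind (C : set 'M[R]_n) :
    (forall (t : R) X Y, 0 <= t <= 1 -> C X -> C Y -> C (t *: X + (1 - t) *: Y)) ->
    (forall p, C (perm_mx p)) ->
  forall X, Bn X -> C X.
Proof.
move=> Cconv Cperm; apply: smallest_sub; last by move=> _ [p _ <-].
move=> X Y t /set_mem CX /set_mem CY; apply/mem_set.
by apply: Cconv => //; rewrite ge0 le1.
Qed.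

Lemma birkhoff_le l c : (forall p, l (perm_mx p) <= c) ->
  forall X, Bn X -> l X <= c.
Proof.
move=> lp; apply: birkhoff_ind => // t X Y /andP[t0 t1] lX lY /=.
rewrite linearD !linearZ /= (_ : c = t * c + (1 - t) * c); last first.
  by rewrite -mulrDl addrC subrK mul1r.
by rewrite lerD // ler_wpM2l // subr_ge0.
Qed.

Lemma birkhoff_ge0 X : Bn X -> forall i j, 0 <= X i j.
Proof.
move: X; apply: birkhoff_ind => [t X Y /andP[t0 t1] X0 Y0|p] i j; rewrite !mxE //.
by rewrite addr_ge0 // mulr_ge0 // subr_ge0.
Qed.

Lemma birkhoff_row_sum X : Bn X -> forall i, \sum_j X i j = 1.
Proof.
move: X; apply: birkhoff_ind => [t X Y _ X1 Y1|p] i.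
  under eq_bigr do rewrite !mxE.
  by rewrite big_split /= -!mulr_sumr X1 Y1 !mulr1 addrC subrK.
rewrite (bigD1 (p i)) //= big1 => [|j jp]; rewrite !mxE ?eqxx ?addr0 //.
by rewrite eq_sym (negPf jp).
Qed.

Definition entry_form (w : 'I_n -> 'I_n -> R) X : R :=
  \sum_i \sum_j w i j * X i j.

Lemma entry_form_is_linear w : scalar (entry_form w).
Proof.
move=> t X Y; rewrite /entry_form mulr_sumr -big_split; apply: eq_bigr => i _ /=.
rewrite mulr_sumr -big_split; apply: eq_bigr => j _ /=.
by rewrite !mxE mulrDr mulrCA.
Qed.

HB.instance Definition _ w :=
  GRing.isLinear.Build R 'M[R]_n R *%R (entry_form w) (entry_form_is_linear w).

Lemma entry_form_perm w p : entry_form w (perm_mx p) = perm_weight R n w p.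
Proof.
apply: eq_bigr => i _; rewrite (bigD1 (p i)) //= big1 => [|j jp]; rewrite !mxE.
  by rewrite eqxx mulr1 addr0.
by rewrite eq_sym (negPf jp) mulr0.
Qed.

Lemma scalar_perm_mx l p :
  l (perm_mx p) = perm_weight R n (fun i j => l (delta_mx i j)) p.
Proof.
rewrite {1}[perm_mx p]matrix_sum_delta linear_sum; apply: eq_bigr => i _.
rewrite linear_sum (bigD1 (p i)) //= big1 => [|j jp]; rewrite linearZ !mxE /=.
  by rewrite eqxx mul1r addr0.
by rewrite eq_sym (negPf jp) mul0r.
Qed.

Lemma perm_face_of_face F : is_face Bn F ->
  perm_face R n [set p | `[< F (perm_mx p) >]].
Proof.
move=> [l [c [l_le ->]]]; exists (fun i j => l (delta_mx i j)), c.
split=> [p|]; first by rewrite -scalar_perm_mx; apply: l_le; apply: birkhoff_perm.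
apply/setP=> p; rewrite !inE -scalar_perm_mx; apply/asboolP/eqP => [[]//|lp].
by split=> //; apply: birkhoff_perm.
Qed.

Lemma face_of_perm_face A : perm_face R n A ->
  exists2 F, is_face Bn F & forall p, F (perm_mx p) <-> p \in A.
Proof.
move=> [w [c [w_le ->]]].
exists (Bn `&` [set X | entry_form w X = c])%classic => [|p].
  exists (entry_form w), c; split=> //; apply: birkhoff_le => p /=.
  by rewrite entry_form_perm.
rewrite inE -entry_form_perm; split=> [[_ /= ->]//|/eqP wp].
by split=> //; apply: birkhoff_perm.
Qed.

Lemma perm_mx_inj : injective (@perm_mx R n).
Proof.
move=> p q /matrixP E; apply/permP=> i; apply/esym/eqP.
by have /eqP := E i (p i); rewrite !mxE eqxx eq_sym pnatr_eq1 eqb1.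
Qed.

(** A functional exposing a vertex attains its maximum at some permutation matrix, which must be
    that vertex. Conversely, the sum of the entries at [(i, p i)] exposes [perm_mx p]. *)
Lemma vertices_birkhoff X : vertices Bn X <-> exists p, X = perm_mx p.
Proof.
split=> [[l [c [l_le defX]]]|[p ->]].
  have [XB lX] : (Bn `&` [set Y | l Y = c])%classic X by rewrite -defX.
  case: (@arg_maxP _ R _ (1%g : 'S_n) predT (fun p => l (perm_mx p))) => //.
  move=> p _ pmax.
  exists p; apply/esym; suff : [set X]%classic (perm_mx p) by [].
  rewrite defX; split; first exact: birkhoff_perm.
  have lp := l_le _ (birkhoff_perm p).
  apply/eqP; rewrite /= eq_le lp /= -lX.
  by apply: (birkhoff_le l) => // q; apply: pmax.
pose w i j : R := (p i == j)%:R.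
have formE Y : entry_form w Y = \sum_i Y i (p i).
  apply: eq_bigr => i _; rewrite (bigD1 (p i)) //= /w eqxx mul1r.
  by rewrite big1 ?addr0 // => j; rewrite eq_sym => /negPf->; rewrite mul0r.
(* Each of the n rows contributes at most its row sum, 1. *)
exists (entry_form w), n%:R; split=> [Y YB /=|].
  rewrite formE -[n in n%:R]card_ord -sum1_card natr_sum.
  apply: ler_sum => i _; rewrite -(birkhoff_row_sum _ YB i) (bigD1 (p i)) //=.
  by rewrite lerDl sumr_ge0 // => j _; apply: birkhoff_ge0.
apply/seteqP; split=> Y /= => [->|[YB]].
  split; [exact: birkhoff_perm | rewrite formE].
  under eq_bigr do rewrite !mxE eqxx.
  by rewrite -natr_sum sum1_card card_ord.
move/eqP; rewrite formE -[n in n%:R]card_ord -sum1_card natr_sum.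
have rest i : \sum_j Y i j - Y i (p i) = \sum_(j | j != p i) Y i j.
  by rewrite (bigD1 (p i)) //= addrAC subrr add0r.
have rest_ge0 i : 0 <= \sum_(j | j != p i) Y i j.
  by rewrite sumr_ge0 // => j _; apply: birkhoff_ge0.
(* Equality makes every nonnegative row defect vanish, so all entries off the positions [(i, p i)]
   are 0. *)
rewrite eq_sym -subr_eq0 -sumrB psumr_eq0 => [/allP Y0|i _]; last first.
  by rewrite -(birkhoff_row_sum _ YB i) rest.
apply/matrixP=> i j; have /eqP := Y0 i (mem_index_enum i).
move=> Yi; rewrite !mxE; have [<-|pj] := eqVneq (p i) j.
  by apply/esym/eqP; rewrite -subr_eq0 Yi.
move/eqP: Yi; rewrite /= -(birkhoff_row_sum _ YB i) rest psumr_eq0 => [/allP|k _].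
  by move=> /(_ j (mem_index_enum j)); rewrite eq_sym pj => /eqP.
exact: birkhoff_ge0.
Qed.

Lemma symmetry_perm (f : 'M[R]_n -> 'M[R]_n) : combinatorial_symmetry Bn f ->
  exists alpha : {perm 'S_n}, (forall p, f (perm_mx p) = perm_mx (alpha p)) /\
    (forall A, perm_face R n A -> perm_face R n (alpha @: A)).
Proof.
move=> [[f_fun f_inj _] f_face].
have permV p : vertices Bn (perm_mx p) by apply/vertices_birkhoff; exists p.
have /choice[a aP] p : exists q, f (perm_mx p) = perm_mx q.
  by apply/vertices_birkhoff/f_fun.
have a_inj : injective a.
  move=> p q E; apply/perm_mx_inj/f_inj; rewrite ?inE //.
  by rewrite !aP E.
exists (perm a_inj); split=> [p|A fA]; first by rewrite permE aP.
have [F faceF FA] := face_of_perm_face _ fA.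
have [G faceG /seteqP[sFG sGF]] := f_face _ faceF.
suff -> : perm a_inj @: A = [set p | `[< G (perm_mx p) >]].
  exact: perm_face_of_face.
apply/setP=> q; rewrite inE; apply/imsetP/asboolP => [[p pA ->]|Gq].
  suff [] : (G `&` vertices Bn)%classic (perm_mx (perm a_inj p)) by [].
  apply: sFG; exists (perm_mx p); last by rewrite permE aP.
  by split; [apply/FA | exact: permV].
have [|Y [FY /vertices_birkhoff[p defY]] fY] := sGF (perm_mx q).
  by split; [|exact: permV].
exists p; first by apply/FA; rewrite -defY.
by apply: perm_mx_inj; rewrite permE -aP -defY fY.
Qed.

End BirkhoffPolytope.

(** * Isometries of the matrix space *)

Section Isometries.
Variables (R : realType) (n : nat).

Lemma euclidean_isometry_perm (sigma tau : 'S_n) :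
  euclidean_isometry (fun X : 'M[R]_n => perm_mx sigma *m X *m perm_mx tau).
Proof.
split.
  exists (fun X => perm_mx sigma^-1 *m X *m perm_mx tau^-1) => X;
    rewrite !mulmxA -perm_mxM -!mulmxA -perm_mxM ?mulVg ?mulgV perm_mx1;
    by rewrite mul1mx ?mulmx1.
move=> X Y; congr Num.sqrt.
(* Both multiplications only permute entries, so the distance is a reindexed sum. *)
have E Z i j : (perm_mx sigma *m Z *m perm_mx tau) i j
               = Z (sigma i) (tau^-1%g j) :> R.
  by rewrite -row_permE -{1}[tau]invgK -col_permE !mxE.
rewrite [RHS](reindex_inj (@perm_inj _ sigma)) /=.
apply: eq_bigr => i _; rewrite [RHS](reindex_inj (@perm_inj _ tau^-1%g)) /=.
by apply: eq_bigr => j _; rewrite !E.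
Qed.

Lemma euclidean_isometry_tr : euclidean_isometry (@trmx R n n).
Proof.
split; first by exists trmx => X; rewrite trmxK.
move=> X Y; congr Num.sqrt; rewrite exchange_big.
by do 2!apply: eq_bigr => ? _; rewrite !mxE.
Qed.

Lemma euclidean_isometry_comp (Phi Psi : 'M[R]_n -> 'M[R]_n) :
  euclidean_isometry Phi -> euclidean_isometry Psi ->
  euclidean_isometry (Phi \o Psi).
Proof.
move=> [bPhi dPhi] [bPsi dPsi]; split; first exact: bij_comp.
by move=> X Y /=; rewrite dPhi dPsi.
Qed.

End Isometries.

Theorem theoremB (R : realType) (n : nat) (n_ge1 : (1 <= n)%N)
    (f : 'M[R]_n -> 'M[R]_n)
    (f_sym : combinatorial_symmetry (@birkhoff R n) f) :
  (exists alpha : {perm 'S_n},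
     (forall pi : 'S_n, f (perm_mx pi) = perm_mx (alpha pi)) /\
     exists (sigma tau : 'S_n) (eps : bool), forall pi : 'S_n,
       alpha pi = (sigma * (if eps then pi^-1 else pi) * tau)%g) /\
  (exists Phi : 'M[R]_n -> 'M[R]_n,
     euclidean_isometry Phi /\
     forall v : 'M[R]_n, vertices (@birkhoff R n) v -> Phi v = f v).
Proof.
have [alpha [f_alpha alpha_face]] := symmetry_perm R n f f_sym.
have [sigma [tau [eps alphaE]]] := perm_face_automorphism R n alpha alpha_face.
split; first by exists alpha; split=> //; exists sigma, tau, eps.
(* Since [perm_mx] is multiplicative and transposition inverts permutation matrices, [Phi], preceded
   by [trmx] if [eps] holds, realizes the formula for [alpha]. *)
pose Phi (X : 'M[R]_n) := perm_mx sigma *m X *m perm_mx tau.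
exists (if eps then Phi \o trmx else Phi); split.
  have isoPhi := euclidean_isometry_perm R n sigma tau.
  case: eps {alphaE} => //.
  exact: euclidean_isometry_comp (euclidean_isometry_tr R n).
move=> _ /vertices_birkhoff[p ->]; rewrite f_alpha alphaE.
by case: eps {alphaE}; rewrite /Phi /= ?tr_perm_mx !perm_mxM.
Qed.
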